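(* Let $\gamma\in[0,1]$, let $n\in\{1,\dots,N\}$, let $(\mathbf{u}^n,p^n)\in V\times W$ be a solution of the time-discrete slightly compressible Darcy-Forchheimer problem (P) described in the context, and let $(\mathbf{u}^{n,i},p^{n,i})_{i\ge 0}\subset V\times W$ be a sequence generated by the $L$-scheme $\gamma$ (S) described in the context. Assume that: (A1) $k>0$ and $\beta>0$; (A2) there exists $M_u\in(0,+\infty)$ (possibly depending on $n$) such that $\|\mathbf{u}^{n,i}\|_{L^\infty(\Omega)}\le M_u$ for all $i$; (A3) $\rho:\mathbb{R}\to\mathbb{R}$ is Lipschitz continuous with Lipschitz constant $L_\rho$, monotonically increasing, and satisfies $0<m_\rho\le\rho(x)\le M_\rho<\infty$ for all $x\in\mathbb{R}$. If the parameter $L$ satisfies $$L>\frac{2k\beta^2M_\rho^2M_u^2\,(1+\gamma^2)}{\mu},$$ then, for a small enough time step $\tau$, the scheme converges. That is, there is $\tau_0>0$, depending only on $\mu,k,\beta,\gamma,L,M_u,m_\rho,M_\rho,L_\rho$, such that if $0<\tau<\tau_0$ then $$\|\mathbf{u}^{n,i}-\mathbf{u}^n\|_{L^2(\Omega)}\to0\quad\text{and}\quad\|p^{n,i}-p^n\|_{L^2(\Omega)}\to0\qquad\text{as } i\to\infty.$$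
   Context: $\Omega\subset\mathbb{R}^d$ is an open bounded domain with Lipschitz continuous boundary, $T>0$ is the final time, $N\ge1$ is an integer, and $\tau=T/N$ is the time step size. $\langle\cdot,\cdot\rangle$ denotes the inner product (integral over $\Omega$ of the product, resp. of the Euclidean dot product) in $L^2(\Omega)$ or $(L^2(\Omega))^d$; the same notation is used for the integral whenever the product is merely integrable. $|\cdot|$ is the Euclidean norm on $\mathbb{R}^d$ and $\|\mathbf{v}\|_{L^\infty(\Omega)}$ is the essential supremum of $|\mathbf{v}|$. The function spaces are $$V=\{\mathbf{v}\in(L^3(\Omega))^d:\nabla\cdot\mathbf{v}\in L^2(\Omega)\},\qquad W=L^2(\Omega).$$ The constants are the viscosity $\mu>0$, the scalar permeability $k$, and the Forchheimer coefficient $\beta$; $\rho:\mathbb{R}\to\mathbb{R}$ is the density as a function of pressure. The source $f^n\in L^2(\Omega)$ and the previous time-level functions $(\mathbf{u}^{n-1},p^{n-1})\in V\times W$ are given. Problem (P) (backward Euler in time, homogeneous Dirichlet boundary conditions for the pressure): find $(\mathbf{u}^n,p^n)\in V\times W$ such that, for all $\mathbf{v}\in V$ and $q\in W$, $$\langle\mu k^{-1}\mathbf{u}^n,\mathbf{v}\rangle+\beta\langle\rho(p^n)|\mathbf{u}^n|\mathbf{u}^n,\mathbf{v}\rangle-\langle p^n,\nabla\cdot\mathbf{v}\rangle=0,$$ $$\langle p^n,q\rangle+\tau\langle\nabla\cdot\mathbf{u}^n,q\rangle=\langle p^{n-1},q\rangle+\tau\langle f^n,q\rangle.$$ Scheme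 (S) ($L$-scheme $\gamma$), with parameters $L\ge0$ and $\gamma\in[0,1]$: set $\mathbf{u}^{n,0}:=\mathbf{u}^{n-1}$ and $p^{n,0}:=p^{n-1}$. For $i\ge1$, given $(\mathbf{u}^{n,i-1},p^{n,i-1})\in V\times W$, find $(\mathbf{u}^{n,i},p^{n,i})\in V\times W$ such that, for all $\mathbf{v}\in V$ and $q\in W$, $$\langle\mu k^{-1}\mathbf{u}^{n,i},\mathbf{v}\rangle+\beta\langle\rho(p^{n,i-1})|\mathbf{u}^{n,i-1}|(\gamma\mathbf{u}^{n,i-1}+(1-\gamma)\mathbf{u}^{n,i}),\mathbf{v}\rangle+L\langle\mathbf{u}^{n,i}-\mathbf{u}^{n,i-1},\mathbf{v}\rangle-\langle p^{n,i},\nabla\cdot\mathbf{v}\rangle=0,$$ $$\langle p^{n,i},q\rangle+\tau\langle\nabla\cdot\mathbf{u}^{n,i},q\rangle=\langle p^{n,0},q\rangle+\tau\langle f^n,q\rangle.$$ *)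

(* Defs.v *)
From HB Require Import structures.
From mathcomp Require Import all_boot all_order all_algebra.
From mathcomp Require Import all_classical all_reals all_analysis.

Set Implicit Arguments.
Unset Strict Implicit.
Unset Printing Implicit Defensive.
Import Order.TTheory GRing.Theory Num.Theory.
Import numFieldNormedType.Exports.
Local Open Scope classical_set_scope.
Local Open Scope ring_scope.

Definition borelRV (R : realType) (d : nat) :=
  g_sigma_algebraType (open : set (set 'rV[R]_d)).

Lemma open_borel (R : realType) (d : nat) (A : set 'rV[R]_d) :
  open A -> measurable (A : set (borelRV R d)).
Proof. exact: sub_sigma_algebra. Qed.

Section borel_coordinates.
Context {R : realType} (n : nat).

Let qball (p : 'rV[rat]_n * rat) : set 'rV[R]_n :=
  [set x | forall j, `|x 0 j - ratr (p.1 0 j)| < ratr p.2].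

Let open_bigcup_qball (U : set 'rV[R]_n) : open U ->
  U = \bigcup_(p in [set p | qball p `<=` U]) qball p.
Proof.
move=> oU; apply/seteqP; split => [x Ux|x [p /= pU]]; last exact: pU.
move: (oU); rewrite openE => /(_ _ Ux) /nbhs_ballP[e /= e0 xeU].
have /rat_in_itvoo[r /itvP r0e] : 0 < e / 2 by rewrite divr_gt0.
have r0 : 0 < ratr r :> R by rewrite r0e.
have /choice[q xq] (i : 'I_n) : exists q : rat, `|x 0 i - ratr q| < ratr r.
  have /rat_in_itvoo[q /itvP xq] : x 0 i - ratr r < x 0 i + ratr r.
    by rewrite ltrBlDr -addrA ltrDl addr_gt0.
  by exists q; rewrite distrC ltr_distl !xq.
exists (\row_i q i, r) => /=; last by move=> j; rewrite mxE.
move=> y yq; apply: xeU; split => // i j; rewrite ord1 /ball/=.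
have -> : x 0 j - y 0 j = (x 0 j - ratr (q j)) - (y 0 j - ratr (q j)).
  by rewrite opprB addrA subrK.
apply: (le_lt_trans (ler_normB _ _)).
have -> : e = e / 2 + e / 2 by rewrite -splitr.
apply: ltrD; first by apply: lt_trans (xq j) _; rewrite r0e.
by have := yq j; rewrite mxE => /lt_trans; apply; rewrite r0e.
Qed.

Lemma measurable_coord (i : 'I_n) :
  measurable_fun setT (fun x : borelRV R n => (x : 'rV[R]_n) 0 i).
Proof.
apply: (measurability _ (measurable_realfun.RGenOpens.measurableE R)).
move=> _ [_ [a [b ->] <-]]; rewrite setTI; apply: open_borel.
by apply: open_comp; [move=> x _; exact: coord_continuous|exact: interval_open].
Qed.

Lemma measurable_fun_rV d (T : measurableType d) (f : T -> 'rV[R]_n) :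
  (forall i, measurable_fun setT (fun x => f x 0 i)) ->
  measurable_fun setT (f : T -> borelRV R n).
Proof.
move=> mf; apply: (@measurability _ _ _ (borelRV R n) _ _ (@open 'rV[R]_n)) => //.
move=> _ [U oU <-]; rewrite setTI (open_bigcup_qball oU) preimage_bigcup.
rewrite bigcup_mkcond; apply: countable_bigcupT_measurable => // p.
case: ifPn => // _.
have -> : f @^-1` qball p = \bigcap_(i : 'I_n)
    ((fun x => f x 0 i) @^-1` [set y | `|y - ratr (p.1 0 i)| < ratr p.2]).
  by apply/seteqP; split => [x h i _|x h i]; [exact: h|exact: (h i)].
apply: fin_bigcap_measurable => // i _.
have -> : [set y : R | `|y - ratr (p.1 0 i)| < ratr p.2] =
    `](ratr (p.1 0 i) - ratr p.2), (ratr (p.1 0 i) + ratr p.2)[%classic.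
  by apply/seteqP; split => y /=; rewrite in_itv/= ltr_distl.
by rewrite -[X in measurable X]setTI; apply: mf => //; exact: measurable_itv.
Qed.
Lemma measurable_box (a b : 'rV[R]_n) :
  measurable ([set x : 'rV[R]_n | forall j, a 0 j <= x 0 j <= b 0 j] :
    set (borelRV R n)).
Proof.
rewrite [X in measurable X](_ : _ = \bigcap_(j : 'I_n)
    ((fun x : 'rV[R]_n => x 0 j) @^-1` `[a 0 j, b 0 j]%classic)).
  apply: fin_bigcap_measurable => // j _; rewrite -[X in measurable X]setTI.
  by apply: measurable_coord => //; exact: measurable_itv.
apply/seteqP; split => [x h j _|x h j]; first by rewrite /= in_itv/= h.
by have := h j I; rewrite /= in_itv.
Qed.

End borel_coordinates.

Section lebesgue_rV_succ.
Context {R : realType} (n : nat).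
Variable nu : {sigma_finite_measure set (borelRV R n) -> \bar R}.
Local Open Scope ereal_scope.

Definition rV_cons (p : measurableTypeR R * borelRV R n) : borelRV R n.+1 :=
  \row_i oapp (fun j => (p.2 : 'rV[R]_n) 0%R j) p.1 (unlift ord0 i).

Lemma measurable_rV_cons : measurable_fun setT rV_cons.
Proof.
apply: measurable_fun_rV => i.
under eq_fun do rewrite mxE.
case: unliftP => [j _|_] /=; last exact: measurable_fst.
by apply: (measurableT_comp (@measurable_coord R n j)); exact: measurable_snd.
Qed.

Definition lebesgue_rV_succ : set (borelRV R n.+1) -> \bar R :=
  pushforward (lebesgue_measure \x nu) rV_cons.

Let lebesgue_rV_succ_measure : {measure set (borelRV R n.+1) -> \bar R} :=
  measure_function_pushforward__canonical__measure_function_Measure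
    (lebesgue_measure \x nu) measurable_rV_cons.

HB.instance Definition _ :=
  Measure.copy lebesgue_rV_succ lebesgue_rV_succ_measure.

Let sigma_finite_lebesgue_rV_succ : sigma_finite setT lebesgue_rV_succ.
Proof.
have /sigma_finiteP[F [FT ndF mF]] := sigma_finiteT (@lebesgue_measure R).
have /sigma_finiteP[G [GT ndG mG]] := sigma_finiteT nu.
pose hd (x : borelRV R n.+1) : measurableTypeR R := (x : 'rV[R]_n.+1) 0%R ord0.
pose tl (x : borelRV R n.+1) : borelRV R n :=
  \row_j (x : 'rV[R]_n.+1) 0%R (lift ord0 j).
have mhd : measurable_fun setT hd by exact: measurable_coord.
have mtl : measurable_fun setT tl.
  apply: measurable_fun_rV => i; under eq_fun do rewrite mxE.
  exact: measurable_coord.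
exists (fun k => hd @^-1` F k `&` tl @^-1` G k).
  apply/esym; rewrite -subTset => x _.
  have : setT (hd x) by []. rewrite FT => -[i _ Fi].
  have : setT (tl x) by []. rewrite GT => -[j _ Gj].
  exists (maxn i j) => //; split => /=.
    by move: Fi; apply/subsetPset/ndF/leq_maxl.
  by move: Gj; apply/subsetPset/ndG/leq_maxr.
move=> k; split.
  by apply: measurableI; rewrite -[X in measurable X]setTI;
    [apply: mhd => //; exact: (mF k).1 | apply: mtl => //; exact: (mG k).1].
rewrite /lebesgue_rV_succ /pushforward.
rewrite (_ : _ @^-1` _ = F k `*` G k).
  rewrite product_measure1E; [|exact: (mF k).1|exact: (mG k).1].
  by rewrite lte_mul_pinfty// ?ge0_fin_numE//; [exact: (mF k).2|exact: (mG k).2].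
have hdE p : hd (rV_cons p) = p.1 by rewrite /hd mxE unlift_none.
have tlE p : tl (rV_cons p) = p.2.
  by apply/rowP => j; rewrite !mxE liftK.
by apply/seteqP; split => p /=; rewrite hdE tlE.
Qed.

HB.instance Definition _ := @Measure_isSigmaFinite.Build _ _ _
  lebesgue_rV_succ sigma_finite_lebesgue_rV_succ.

End lebesgue_rV_succ.

Fixpoint lebesgue_rV (R : realType) (d : nat) :
    {sigma_finite_measure set (borelRV R d) -> \bar R} :=
  match d with
  | 0 => @dirac _ (borelRV R 0) (0 : 'rV[R]_0) R
  | n.+1 => lebesgue_rV_succ (lebesgue_rV R n)
  end.

Lemma lebesgue_rV_box (R : realType) (d : nat) (a b : 'rV[R]_d) :
  (forall j, a 0 j <= b 0 j) ->
  lebesgue_rV R d [set x : 'rV[R]_d | forall j, a 0 j <= x 0 j <= b 0 j]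
    = (\prod_j (b 0 j - a 0 j))%:E.
Proof.
elim: d a b => [|n IHn] a b ab.
  rewrite /= diracE mem_set ?big_ord0//; by case.
pose tl (v : 'rV[R]_n.+1) : 'rV[R]_n := \row_j v 0 (lift ord0 j).
rewrite /= /lebesgue_rV_succ /pushforward.
rewrite (_ : _ @^-1` _ = `[a 0 ord0, b 0 ord0]%classic `*`
    [set x : 'rV[R]_n | forall j, tl a 0 j <= x 0 j <= tl b 0 j]).
  rewrite product_measure1E//=; last exact: measurable_box.
  rewrite lebesgue_measure_itv/= IHn; last by move=> j; rewrite !mxE.
  rewrite big_ord_recl lte_fin; under eq_bigr do rewrite !mxE.
  case: ltP => [_|ba]; first by rewrite -EFinB -EFinM.
  have -> : b 0 ord0 = a 0 ord0 by apply/eqP; rewrite eq_le ba ab.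
  by rewrite subrr mul0r mul0e.
apply/seteqP; split => p /=; rewrite in_itv/=.
  move=> h; split => [|j]; first by have := h ord0; rewrite mxE unlift_none.
  by have := h (lift ord0 j); rewrite !mxE liftK.
move=> [h0 h] j; rewrite mxE; case: unliftP => [i ->|->] //=.
by have := h i; rewrite !mxE.
Qed.

Section spaces.
Context {R : realType} (d : nat).
Implicit Types (u v : 'rV[R]_d -> 'rV[R]_d) (p q g phi : 'rV[R]_d -> R).

Definition dotv (x y : 'rV[R]_d) : R := \sum_j x 0 j * y 0 j.

Definition enorm (x : 'rV[R]_d) : R := Num.sqrt (dotv x x).

Definition partial (j : 'I_d) phi : 'rV[R]_d -> R := 'D_(delta_mx 0 j) phi.

Definition grad phi (x : 'rV[R]_d) : 'rV[R]_d := \row_j partial j phi x.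

(* C^oo: iterated partial derivatives of every order exist and are continuous. *)
Definition smooth phi := forall s : seq 'I_d,
  let psi := foldr partial phi s in
  continuous psi /\ forall j x, derivable psi x (delta_mx 0 j).

Definition tsupport phi : set 'rV[R]_d := closure [set x | phi x != 0].

Definition test_function (Omega : set 'rV[R]_d) phi :=
  [/\ smooth phi, compact (tsupport phi) & tsupport phi `<=` Omega].

Variables (Omega : set 'rV[R]_d) (oOmega : open Omega).

Definition lebesgue_on : {measure set (borelRV R d) -> \bar R} :=
  mrestr (lebesgue_rV R d) (open_borel oOmega).

(* Elements of L^p(Omega) are represented by functions on the whole of R^d;
   lebesgue_on does not see their values outside Omega. *)
Definition ip p q : R := \int[lebesgue_on]_x (p x * q x).

Definition ipv u v : R := \int[lebesgue_on]_x dotv (u x) (v x).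

(* g represents the distributional divergence of v, which lies in L^2(Omega).
   Divergence is kept as a relation: a class of functions equal a.e. has no
   preferred representative. *)
Definition weak_div v g :=
  (g : borelRV R d -> R) \in Lfun lebesgue_on 2%:E /\
  forall phi, test_function Omega phi -> ip g phi = - ipv v (grad phi).

Definition Wspace q := (q : borelRV R d -> R) \in Lfun lebesgue_on 2%:E.

Definition Vspace v :=
  (forall j, (fun x : borelRV R d => v x 0 j) \in Lfun lebesgue_on 3%:E) /\
  exists g, weak_div v g.

Definition forchheimer_solution (mu k beta tau : R) (rho : R -> R)
    (f p0 : 'rV[R]_d -> R) u p :=
  [/\ Vspace u, Wspace p,
    forall v divv, Vspace v -> weak_div v divv ->
      ipv (fun x => (mu * k^-1) *: u x) v
      + beta * ipv (fun x => (rho (p x) * enorm (u x)) *: u x) v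
      - ip p divv = 0
  & forall divu q, weak_div u divu -> Wspace q ->
      ip p q + tau * ip divu q = ip p0 q + tau * ip f q].

(* One iteration, from (u', p') to (u, p). *)
Definition Lscheme_step (mu k beta gamma L tau : R) (rho : R -> R)
    (f p0 : 'rV[R]_d -> R) u' p' u p :=
  [/\ Vspace u, Wspace p,
    forall v divv, Vspace v -> weak_div v divv ->
      ipv (fun x => (mu * k^-1) *: u x) v
      + beta * ipv (fun x => (rho (p' x) * enorm (u' x)) *:
                             (gamma *: u' x + (1 - gamma) *: u x)) v
      + L * ipv (fun x => u x - u' x) v
      - ip p divv = 0
  & forall divu q, weak_div u divu -> Wspace q ->
      ip p q + tau * ip divu q = ip p0 q + tau * ip f q].

Definition Lscheme (mu k beta gamma L tau : R) (rho : R -> R)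
    (f p0 : 'rV[R]_d -> R) (u0 : 'rV[R]_d -> 'rV[R]_d)
    (u : nat -> 'rV[R]_d -> 'rV[R]_d) (p : nat -> 'rV[R]_d -> R) :=
  [/\ u 0%N = u0, p 0%N = p0 &
    forall i, Lscheme_step mu k beta gamma L tau rho f (p 0%N)
                (u i) (p i) (u i.+1) (p i.+1)].

Definition Linfty_norm u : \bar R :=
  'N[lebesgue_on]_+oo[(fun x => (enorm (u x))%:E)]%E.

Definition L2_norm q : \bar R := 'N[lebesgue_on]_2%:E[(fun x => (q x)%:E)]%E.

Definition L2_normv u : \bar R :=
  'N[lebesgue_on]_2%:E[(fun x => (enorm (u x))%:E)]%E.

End spaces.

(* Near every boundary point Omega is, in suitable orthonormal coordinates
   y = x *m Q, the strict epigraph of a Lipschitz function of the first d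
   coordinates. *)
Definition lipschitz_boundary (R : realType) (d : nat)
    (Omega : set 'rV[R]_d.+1) :=
  forall x0, (closure Omega `\` interior Omega) x0 ->
  exists (Q : 'M[R]_d.+1) (h : 'rV[R]_d -> R),
    [/\ Q *m Q^T = 1%:M, (lipschitz h) &
      \forall x \near x0, Omega x <->
        h (\row_j (x *m Q) 0 (widen_ord (leqnSn d) j)) < (x *m Q) 0 ord_max].

Definition lipschitz_domain (R : realType) (d : nat)
    (Omega : set 'rV[R]_d.+1) :=
  [/\ Omega !=set0, connected Omega, bounded_set Omega &
      lipschitz_boundary Omega].

(* Main.v *)
(* Subtract problem (P) from the scheme and test with the errors
   e = u^{n,i} - u^n and s = p^{n,i} - p^n.  With e', s' the previous errors,
   the Forchheimer difference is written as
     rho(p')|u'| gamma (u' - u^{n,i}) + (rho(p') - rho(p^n))|u'| u^{n,i}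
     + rho(p^n)(|u'| - |u^{n,i}|) u^{n,i}
     + rho(p^n)(|u^{n,i}| u^{n,i} - |u^n| u^n),
   whose last term is monotone, so that only the iterates need to be bounded.
   Young's inequality and the lower bound on L give
     (mu/(4k) + L/2)|e|^2 + |s|^2/tau <= L/2 |e'|^2 + C |s'|^2
   with C = k beta^2 L_rho^2 M_u^4 / mu, a contraction as soon as C < 1/tau. *)
Require Import Defs.
From HB Require Import structures.
From mathcomp Require Import all_boot all_order all_algebra.
From mathcomp Require Import all_classical all_reals all_analysis.
From mathcomp Require Import measurable_realfun ess_sup_inf.
From mathcomp Require Import ring lra.

Set Implicit Arguments.
Unset Strict Implicit.
Unset Printing Implicit Defensive.
Import Order.TTheory GRing.Theory Num.Theory.
Import numFieldNormedType.Exports.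
Local Open Scope classical_set_scope.
Local Open Scope ring_scope.

(** * Euclidean geometry of row vectors *)

Section dotv_theory.
Context {R : realType} (d : nat).
Implicit Types (x y z : 'rV[R]_d) (a : R).

Lemma dotvC x y : dotv x y = dotv y x.
Proof. by apply: eq_bigr => j _; rewrite mulrC. Qed.

Lemma dotvDl x y z : dotv (x + y) z = dotv x z + dotv y z.
Proof. by rewrite -big_split; apply: eq_bigr => j _; rewrite mxE mulrDl. Qed.

Lemma dotvZl a x y : dotv (a *: x) y = a * dotv x y.
Proof. by rewrite big_distrr; apply: eq_bigr => j _; rewrite mxE -mulrA. Qed.

Lemma dotvNl x y : dotv (- x) y = - dotv x y.
Proof. by rewrite -scaleN1r dotvZl mulN1r. Qed.

Lemma dotvDr x y z : dotv x (y + z) = dotv x y + dotv x z.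
Proof. by rewrite dotvC dotvDl !(dotvC _ x). Qed.

Lemma dotvNr x y : dotv x (- y) = - dotv x y.
Proof. by rewrite dotvC dotvNl dotvC. Qed.

Lemma dotvZr a x y : dotv x (a *: y) = a * dotv x y.
Proof. by rewrite dotvC dotvZl dotvC. Qed.

Lemma dotvv_ge0 x : 0 <= dotv x x.
Proof. by apply: sumr_ge0 => j _; rewrite -expr2 sqr_ge0. Qed.

Lemma enorm_ge0 x : 0 <= enorm x.
Proof. exact: sqrtr_ge0. Qed.

Lemma sqr_enorm x : enorm x ^+ 2 = dotv x x.
Proof. by rewrite sqr_sqrtr// dotvv_ge0. Qed.

Lemma sqr_enormB x y :
  enorm (x - y) ^+ 2 = enorm x ^+ 2 + enorm y ^+ 2 - 2 * dotv x y.
Proof.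
by rewrite !sqr_enorm !(dotvDl, dotvDr, dotvNl, dotvNr) (dotvC y x); ring.
Qed.

(** For [y] nonzero, the squared length of [dotv y y *: x - dotv x y *: y] factors as [dotv y y]
    times the defect of the squared inequality. The case [dotv y y = 0] forces every coordinate of
    [y] to vanish. *)
Lemma cauchy_schwarz x y : `|dotv x y| <= enorm x * enorm y.
Proof.
rewrite -ler_sqr ?nnegrE ?mulr_ge0 ?enorm_ge0//.
rewrite real_normK ?num_real// exprMn !sqr_enorm.
have [y0|y_neq0] := eqVneq (dotv y y) 0.
  suff -> : dotv x y = 0 by rewrite expr0n mulr_ge0 ?dotvv_ge0.
  apply: big1 => j _; suff -> : y 0 j = 0 by rewrite mulr0.
  apply/eqP; rewrite -sqrf_eq0 expr2; apply/eqP; move: j (erefl true).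
  by apply: psumr_eq0P y0 => j _; rewrite -expr2 sqr_ge0.
have y_gt0 : 0 < dotv y y by rewrite lt_def y_neq0 dotvv_ge0.
have := dotvv_ge0 (dotv y y *: x - dotv x y *: y).
rewrite !(dotvDl, dotvDr, dotvNl, dotvNr, dotvZl, dotvZr) (dotvC y x).
rewrite [leRHS](_ : _ = dotv y y * (dotv x x * dotv y y - dotv x y ^+ 2));
  last by ring.
by rewrite pmulr_rge0// subr_ge0.
Qed.

Lemma ler_dist_enorm x y : `|enorm x - enorm y| <= enorm (x - y).
Proof.
rewrite -ler_sqr ?nnegrE ?enorm_ge0// real_normK ?num_real// sqr_enormB.
by have := le_trans (ler_norm _) (cauchy_schwarz x y); lra.
Qed.

(** The pairing expands to |x|^3 + |y|^3 - (|x| + |y|) x.y. Replacing x.y by its upper bound |x| |y|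
    leaves (|x| + |y|) (|x| - |y|)^2. *)
Lemma enorm_monotone x y :
  0 <= dotv (enorm x *: x - enorm y *: y) (x - y).
Proof.
rewrite !(dotvDl, dotvDr, dotvNl, dotvNr, dotvZl, dotvZr) -!sqr_enorm (dotvC y).
have := mulr_ge0 (addr_ge0 (enorm_ge0 x) (enorm_ge0 y))
  (sqr_ge0 (enorm x - enorm y)).
have : (enorm x + enorm y) * dotv x y
    <= (enorm x + enorm y) * (enorm x * enorm y).
  rewrite ler_wpM2l ?addr_ge0 ?enorm_ge0//.
  exact: le_trans (ler_norm _) (cauchy_schwarz x y).
by lra.
Qed.

(** Expanding the square of the sum gives the squared coordinates plus nonnegative cross terms. The
    bound reduces integrability of the Euclidean norm to that of the coordinates. *)
Lemma enorm_le_sum x : enorm x <= \sum_j `|x 0 j|.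
Proof.
rewrite -ler_sqr ?nnegrE ?enorm_ge0 ?sumr_ge0// sqr_enorm expr2 big_distrl/=.
apply: ler_sum => j _; rewrite (bigD1 j)//= mulrDr -normrM.
by rewrite (le_trans (ler_norm _))// lerDl mulr_ge0// sumr_ge0.
Qed.

End dotv_theory.

(** * Pointwise estimates for one iteration, and a contraction principle for a pair of real
    sequences *)

Section young.
Context {R : realFieldType}.
Implicit Types a b c x y : R.

(** Multiplied by 2a, the difference of the two sides is (a x - c y)^2 + (a b - c^2) y^2. The
    condition on [c ^+ 2] is the form in which the threshold on [L] becomes available. *)
Lemma young_mul a b c x y : 0 < a -> c ^+ 2 <= a * b ->
  c * (x * y) <= a / 2 * x ^+ 2 + b / 2 * y ^+ 2.
Proof.
move=> a0 cab; rewrite -subr_ge0 -(pmulr_rge0 _ (mulr_gt0 (ltr0Sn R 1) a0)).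
have := mulr_ge0 (sqr_ge0 y) (etrans (subr_ge0 _ _) cab).
have := sqr_ge0 (a * x - c * y).
rewrite -subr_ge0 in cab.
by lra.
Qed.

End young.

(* [x'], [x], [y] are the values of the previous iterate, the new iterate and
   the exact velocity; [r'], [r] those of the previous and the exact density. *)
Lemma forchheimer_coercive {R : realType} (d : nat)
    (mu k beta gamma L M Mrho Lrho r r' s : R) (x' x y : 'rV[R]_d) :
  0 < mu -> 0 < k -> 0 < beta -> 0 <= gamma -> 0 < L ->
  2 * k * beta ^+ 2 * Mrho ^+ 2 * M ^+ 2 * (1 + gamma ^+ 2) / mu <= L ->
  enorm x' <= M -> enorm x <= M ->
  0 <= r <= Mrho -> 0 <= r' <= Mrho -> `|r' - r| <= Lrho * `|s| ->
  (mu / k / 4 + L / 2) * dotv (x - y) (x - y)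
    - (L / 2 * dotv (x' - y) (x' - y)
       + k * beta ^+ 2 * Lrho ^+ 2 * M ^+ 4 / mu * s ^+ 2)
  <= dotv ((mu / k) *: (x - y)
       + beta *: ((r' * enorm x') *: (gamma *: x' + (1 - gamma) *: x)
                  - (r * enorm y) *: y)
       + L *: (x - x')) (x - y).
Proof.
move=> mu0 k0 beta0 gamma0 L0 Llarge x'M xM /andP[r0 rM] /andP[r'0 r'M] r'r.
have M0 : 0 <= M := le_trans (enorm_ge0 x) xM.
have Mrho0 : 0 <= Mrho := le_trans r0 rM.
set e := x - y; set nu := mu / k; set E := enorm e; set D := enorm (x - x').
have nu0 : 0 < nu by rewrite divr_gt0.
have E0 : 0 <= E by exact: enorm_ge0.
have D0 : 0 <= D by exact: enorm_ge0.
rewrite -!sqr_enorm -/e -/E.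
(* By this identity the stabilisation term L (x - x').e equals L/2 (|e|^2 + D^2 - |x' - y|^2). The
   surplus L/2 D^2 is what absorbs the terms containing the increment x - x'. *)
have -> : enorm (x' - y) ^+ 2 = E ^+ 2 + D ^+ 2 - 2 * dotv (x - x') e.
  rewrite (_ : x' - y = e - (x - x')).
    by rewrite sqr_enormB -/E -/D (dotvC e).
  by apply/rowP => j; rewrite /e !mxE; ring.
have split_forchheimer :
    (r' * enorm x') *: (gamma *: x' + (1 - gamma) *: x) - (r * enorm y) *: y
    = (- (r' * enorm x' * gamma)) *: (x - x')
      + ((r' - r) * enorm x') *: x
      + (r * (enorm x' - enorm x)) *: x
      + r *: (enorm x *: x - enorm y *: y).
  by apply/rowP => j; rewrite !mxE; ring.
have expand (a b c1 c2 c3 c4 c5 : R) (f h g : 'rV[R]_d) :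
    dotv (a *: e + b *: (c1 *: f + c2 *: h + c3 *: h + c4 *: g) + c5 *: f) e
    = a * dotv e e + b * (c1 * dotv f e + c2 * dotv h e + c3 * dotv h e
        + c4 * dotv g e) + c5 * dotv f e.
  by clearbody e; rewrite !(dotvDl, dotvZl).
rewrite split_forchheimer expand -sqr_enorm -/E.
have := enorm_monotone x y; rewrite -/e.
have a'aD : `|enorm x' - enorm x| <= D by rewrite distrC ler_dist_enorm.
have a'0 := enorm_ge0 x'.
have xe : `|dotv x e| <= M * E.
  by rewrite (le_trans (cauchy_schwarz _ _))// ler_wpM2r.
have := cauchy_schwarz (x - x') e; rewrite -/E -/D.
set P1 := dotv (x - x') e; set P3 := dotv _ e => P1DE P30.
have t1 : r' * enorm x' * gamma * P1 <= Mrho * M * gamma * (D * E).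
  rewrite (le_trans (ler_norm _))// normrM ger0_norm ?mulr_ge0//.
  by rewrite ler_pM ?mulr_ge0// ler_wpM2r// ler_pM.
have t2 : - ((r' - r) * enorm x' * dotv x e) <= Lrho * M ^+ 2 * (E * `|s|).
  rewrite (le_trans (ler_norm _))// normrN !normrM (ger0_norm a'0).
  rewrite [leRHS](_ : _ = Lrho * `|s| * M * (M * E)); last by ring.
  by rewrite ler_pM ?mulr_ge0// ler_pM.
have t3 : - (r * (enorm x' - enorm x) * dotv x e) <= Mrho * M * (D * E).
  rewrite (le_trans (ler_norm _))// normrN !normrM (ger0_norm r0).
  rewrite [leRHS](_ : _ = Mrho * D * (M * E)); last by ring.
  by rewrite ler_pM ?mulr_ge0// ler_pM.
have t4 := mulr_ge0 r0 P30.
set C := k * beta ^+ 2 * Lrho ^+ 2 * M ^+ 4 / mu.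
(* The lower bound on [L] is used here: (1 + gamma)^2 <= 2 (1 + gamma^2) accounts for its factor,
   and the increment terms consume all of L/2 D^2 and half of the Darcy term nu E^2. *)
have y1 : beta * Mrho * M * (1 + gamma) * (D * E)
    <= L / 2 * D ^+ 2 + nu / 2 * E ^+ 2.
  apply: young_mul => //.
  have : 2 * k * beta ^+ 2 * Mrho ^+ 2 * M ^+ 2 * (1 + gamma ^+ 2) / mu * nu
      <= L * nu by rewrite ler_pM2r.
  apply: le_trans.
  rewrite [leRHS](_ : _ = (beta * Mrho * M) ^+ 2 * (2 * (1 + gamma ^+ 2)));
    last by rewrite /nu; field; rewrite !gt_eqF.
  rewrite exprMn ler_wpM2l ?sqr_ge0//.
  by have := sqr_ge0 (1 - gamma); lra.
(* [C] is the value for which the Young condition with weights nu/2 and 2C is an equality. This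
   costs another nu/4 of the Darcy term, so that the final coefficient is nu - nu/2 - nu/4 =
   mu/(4k). *)
have y2 : beta * Lrho * M ^+ 2 * (E * `|s|)
    <= nu / 2 / 2 * E ^+ 2 + (2 * C) / 2 * `|s| ^+ 2.
  apply: young_mul; first by rewrite divr_gt0.
  rewrite le_eqVlt; apply/orP; left; apply/eqP.
  by rewrite /C /nu; field; rewrite !gt_eqF.
rewrite real_normK ?num_real// in y2.
have := ler_wpM2l (ltW beta0) t1; have := ler_wpM2l (ltW beta0) t2.
have := ler_wpM2l (ltW beta0) t3; have := mulr_ge0 (ltW beta0) t4.
lra.
Qed.

(** The weighted sum [A * a i + B * b i] shrinks at each step by the factor max(A'/A, B'/B) < 1, and
    it dominates each of its two nonnegative terms. *)
Lemma cvg0_of_weighted_contraction {R : realType} (A A' B B' : R)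
    (a b : nat -> R) :
  0 <= A' < A -> 0 <= B' < B -> (forall i, 0 <= a i) -> (forall i, 0 <= b i) ->
  (forall i, A * a i.+1 + B * b i.+1 <= A' * a i + B' * b i) ->
  a i @[i --> \oo] --> 0 /\ b i @[i --> \oo] --> 0.
Proof.
move=> /andP[A'0 A'A] /andP[B'0 B'B] a0 b0 ab.
have A0 : 0 < A := le_lt_trans A'0 A'A.
have B0 : 0 < B := le_lt_trans B'0 B'B.
pose theta := Num.max (A' / A) (B' / B).
pose X i := A * a i + B * b i.
have theta0 : 0 <= theta by rewrite le_max divr_ge0// ltW.
have theta1 : `|theta| < 1.
  by rewrite ger0_norm// gt_max !ltr_pdivrMr// !mul1r A'A B'B.
have Xtheta i : X i <= geometric (X 0%N) theta i.
  elim: i => [|i IHi]; first by rewrite /geometric/= expr0 mulr1.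
  rewrite /geometric/= exprSr mulrA (le_trans _ (ler_wpM2r theta0 IHi))//.
  apply: (le_trans (ab i)); rewrite /X mulrDl; apply: lerD.
    by rewrite mulrAC ler_wpM2r// mulrC -ler_pdivrMr// le_max lexx.
  by rewrite mulrAC ler_wpM2r// mulrC -ler_pdivrMr// le_max lexx orbT.
have X_cvg0 c : c * geometric (X 0%N) theta i @[i --> \oo] --> 0.
  by rewrite -(mulr0 c); apply: cvgMr; exact: cvg_geometric.
split.
- apply: (squeeze_cvgr _ (cvg_cst 0) (X_cvg0 A^-1)); near=> i.
  rewrite a0/= ler_pdivlMl// (le_trans _ (Xtheta i))// lerDl.
  by rewrite mulr_ge0// ltW.
- apply: (squeeze_cvgr _ (cvg_cst 0) (X_cvg0 B^-1)); near=> i.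
  rewrite b0/= ler_pdivlMl// (le_trans _ (Xtheta i))// lerDr.
  by rewrite mulr_ge0// ltW.
Unshelve. all: by end_near. Qed.

(** * Integrability and linearity of integrals in Lebesgue spaces *)

Section Lfun_lemmas.
Context d (T : measurableType d) (R : realType).
Variable mu : {measure set T -> \bar R}.
Implicit Types f g h : T -> R.

Lemma measurable_Lfun p f : f \in Lfun mu p -> measurable_fun setT f.
Proof. by rewrite inE => /andP[/[!inE]]. Qed.

Lemma Lfun_dominated (r : R) f g : 0 <= r -> measurable_fun setT f ->
  (forall x, `|f x| <= `|g x|) -> g \in Lfun mu r%:E -> f \in Lfun mu r%:E.
Proof.
move=> r0 mf fg /[dup] /measurable_Lfun mg; rewrite !inE => /andP[_].
have mpow (h : T -> R) : measurable_fun setT h ->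
    measurable_fun setT (fun x => (`|h x| `^ r)%:E).
  move=> mh; apply/measurable_EFinP.
  apply: (measurableT_comp (measurable_powR _)) => //.
  exact: measurableT_comp.
rewrite !inE/= /finite_norm => gfin; apply/andP; split; rewrite inE//=.
rewrite /finite_norm; apply: le_lt_trans gfin; rewrite unlock/=.
have pos (h : T -> R) : (0 <= \int[mu]_x (`|h x| `^ r)%:E)%E.
  by apply: integral_ge0 => x _; rewrite lee_fin powR_ge0.
apply: gt0_ler_poweR; rewrite ?invr_ge0// ?in_itv/= ?leey ?andbT ?pos//.
apply: ge0_le_integral => //; [exact: mpow|exact: mpow|].
by move=> x _; rewrite lee_fin ge0_ler_powR// nnegrE.
Qed.

Lemma Lfun_bounded_mul (r M : R) f g : 1 <= r -> measurable_fun setT f ->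
  (forall x, `|f x| <= M) -> g \in Lfun mu r%:E ->
  (fun x => f x * g x) \in Lfun mu r%:E.
Proof.
move=> r1 mf fM gr; have r0 : 0 <= r by rewrite (le_trans _ r1).
apply: (Lfun_dominated r0 _ _ (Lfun_scale M r1 gr)).
  by apply: measurable_funM => //; exact: measurable_Lfun gr.
move=> x; rewrite /= !normrM mulrC ler_wpM2l//.
exact: le_trans (fM x) (ler_norm M).
Qed.

(** A product of three nonnegative numbers is at most the cube of the largest, hence at most the sum
    of the three cubes. This makes the Forchheimer pairing of L^3 fields integrable. *)
Lemma Lfun3_mul_Lfun1 f g h : f \in Lfun mu 3%:E -> g \in Lfun mu 3%:E ->
  h \in Lfun mu 3%:E -> (fun x => f x * g x * h x) \in Lfun mu 1.
Proof.
move=> f3 g3 h3; apply/Lfun1_integrable.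
have cube (k : T -> R) : k \in Lfun mu 3%:E ->
    mu.-integrable setT (EFin \o (fun x => `|k x| ^+ 3)).
  move=> /Lfun_integrable => /(_ (ler1n _ 3)).
  by under eq_fun do rewrite powR_mulrn//.
apply: le_integrable (integrableD _ (integrableD _ (cube f f3) (cube g g3))
  (cube h h3)) => //.
  by apply/measurable_EFinP; do 2?apply: measurable_funM;
    [exact: measurable_Lfun f3|exact: measurable_Lfun g3|
     exact: measurable_Lfun h3].
move=> x _ /=; rewrite lee_fin [leRHS]ger0_norm ?addr_ge0 ?exprn_ge0// !normrM.
suff cube_le (a b c : R) : 0 <= a -> 0 <= b -> 0 <= c ->
    a * b * c <= a ^+ 3 + b ^+ 3 + c ^+ 3 by exact: cube_le.
move=> a0 b0 c0; pose m := Num.max a (Num.max b c).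
have [am bm cm] : [/\ a <= m, b <= m & c <= m].
  by rewrite /m !le_max !lexx !orbT.
have abc : a * b * c <= m ^+ 3.
  by rewrite (exprSr m 2) expr2 !ler_pM ?mulr_ge0.
apply: (le_trans abc); rewrite /m.
have := exprn_ge0 3 a0; have := exprn_ge0 3 b0; have := exprn_ge0 3 c0.
by case: (leP b c) => _; [case: (leP a c) | case: (leP a b)] => _; lra.
Qed.

Lemma Lfun2_Lnorm f : f \in Lfun mu 2%:E ->
  'N[mu]_2%:E[(fun x => (f x)%:E)]%E = (Num.sqrt (\int[mu]_x (f x ^+ 2)))%:E.
Proof.
move=> f2; have intf := Lfun2_integrable_sqr f2.
rewrite unlock/=.
under eq_integral => x _.
  rewrite (powR_mulrn 2)// real_normK ?num_real//.
  over.
have -> : (\int[mu]_x (f x ^+ 2)%:E)%E = (\int[mu]_x (f x ^+ 2))%:E.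
  by rewrite fineK// integrable_fin_num.
by rewrite poweR_EFin powR12_sqrt// Rintegral_ge0// => x _; exact: sqr_ge0.
Qed.

Lemma Rintegral_linear (a : R) f g : f \in Lfun mu 1 -> g \in Lfun mu 1 ->
  \int[mu]_x (a * f x + g x) = a * \int[mu]_x f x + \int[mu]_x g x.
Proof.
move=> f1 g1; have intf := (Lfun1_integrable _ _).1 f1.
have af1 : (fun x => a * f x) \in Lfun mu 1 by exact: (rpredZ a f1).
rewrite RintegralD//; [|exact/Lfun1_integrable..].
by rewrite RintegralZl.
Qed.

Lemma Rintegral_sub f g : f \in Lfun mu 1 -> g \in Lfun mu 1 ->
  \int[mu]_x (f x - g x) = \int[mu]_x f x - \int[mu]_x g x.
Proof. by move=> f1 g1; rewrite RintegralB//; exact/Lfun1_integrable. Qed.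

(** Replacing g by max(f, g) does not change its integral and turns the almost everywhere inequality
    into one valid at every point. *)
Lemma ae_le_Rintegral f g : f \in Lfun mu 1 -> g \in Lfun mu 1 ->
  {ae mu, forall x, f x <= g x} -> \int[mu]_x f x <= \int[mu]_x g x.
Proof.
move=> f1 g1 fg; have [mf mg] := (measurable_Lfun f1, measurable_Lfun g1).
have max1 : (fun x => Num.max (f x) (g x)) \in Lfun mu 1.
  have sum1 : (fun x => `|f x| + `|g x|) \in Lfun mu 1.
    exact: (rpredD (Lfun_norm f1) (Lfun_norm g1)).
  apply: (Lfun_dominated _ _ _ sum1) => //; first exact: measurable_maxr.
  move=> x /=; rewrite [leRHS]ger0_norm ?addr_ge0//.
  by rewrite /Num.max; case: ifP => _; rewrite ?lerDl ?lerDr.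
have -> : \int[mu]_x g x = \int[mu]_x Num.max (f x) (g x).
  congr fine; apply: ae_eq_integral => //.
  - exact/measurable_EFinP.
  - by apply/measurable_EFinP; exact: measurable_maxr.
  - by apply: filterS fg => x fgx _; rewrite max_r.
apply: le_Rintegral => //; [exact/Lfun1_integrable..|].
by move=> x _; rewrite le_max lexx.
Qed.

End Lfun_lemmas.

(** * Vector fields with components in L^3 *)

Section L3_fields.
Context disp (T : measurableType disp) (R : realType) (n : nat).
Variable mu : {measure set T -> \bar R}.
Implicit Types (f : T -> R) (a v w : T -> 'rV[R]_n).

Let le1_3 : (1 <= 3%:E :> \bar R)%E. Proof. by rewrite lee_fin ler1n. Qed.

(** The integrability half of membership in V, separated from the weak divergence because the
    pairings below require only this half. *)
Definition L3field v := forall j, (fun x => v x 0 j) \in Lfun mu 3%:E.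

Lemma L3fieldB v w : L3field v -> L3field w -> L3field (fun x => v x - w x).
Proof.
move=> v3 w3 j; rewrite (_ : (fun _ => _) = (fun x => v x 0 j - w x 0 j)).
  by apply: (rpredB (v3 j) (w3 j)); exact: le1_3.
by apply/funext => x; rewrite !mxE.
Qed.

Lemma L3fieldD v w : L3field v -> L3field w -> L3field (fun x => v x + w x).
Proof.
move=> v3 w3 j; rewrite (_ : (fun _ => _) = (fun x => v x 0 j + w x 0 j)).
  by apply: (rpredD (v3 j) (w3 j)); exact: le1_3.
by apply/funext => x; rewrite !mxE.
Qed.

Lemma L3fieldZ (c : R) v : L3field v -> L3field (fun x => c *: v x).
Proof.
move=> v3 j; rewrite (_ : (fun _ => _) = (fun x => c * v x 0 j)).
  by apply: (rpredZ c (v3 j)); exact: le1_3.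
by apply/funext => x; rewrite !mxE.
Qed.

Lemma measurable_dotv v w :
  (forall j, measurable_fun setT (fun x => v x 0 j)) ->
  (forall j, measurable_fun setT (fun x => w x 0 j)) ->
  measurable_fun setT (fun x => dotv (v x) (w x)).
Proof. by move=> mv mw; apply: measurable_sum => j; exact: measurable_funM. Qed.

Lemma measurable_enorm v : (forall j, measurable_fun setT (fun x => v x 0 j)) ->
  measurable_fun setT (fun x => enorm (v x)).
Proof.
move=> mv; apply: (measurableT_comp (continuous_measurable_fun _)).
  exact: sqrt_continuous.
exact: measurable_dotv.
Qed.

Lemma Lfun3_enorm v : L3field v -> (fun x => enorm (v x)) \in Lfun mu 3%:E.
Proof.
move=> v3; have sum3 : (\sum_j (fun x => `|v x 0 j|)) \in Lfun mu 3%:E.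
  apply: rpred_sum => j _; apply: (Lfun_dominated _ _ _ (v3 j)) => //.
    by apply: measurableT_comp => //; exact: measurable_Lfun (v3 j).
  by move=> x; rewrite normr_id.
apply: (Lfun_dominated _ _ _ sum3) => //.
  by apply: measurable_enorm => j; exact: measurable_Lfun (v3 j).
move=> x; rewrite fct_sumE !ger0_norm ?enorm_ge0 ?sumr_ge0//.
exact: enorm_le_sum.
Qed.

Lemma Lfun1_dotv_scale f a v :
  f \in Lfun mu 3%:E -> L3field a -> L3field v ->
  (fun x => dotv (f x *: a x) (v x)) \in Lfun mu 1.
Proof.
move=> f3 a3 v3.
rewrite (_ : (fun _ => _) = \sum_j (fun x => f x * a x 0 j * v x 0 j)).
  by apply: rpred_sum => j _; exact: Lfun3_mul_Lfun1.
by apply/funext => x; rewrite fct_sumE; apply: eq_bigr => j _; rewrite mxE.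
Qed.

(** On a space of finite measure L^3 embeds in L^2; this is what makes the Darcy and stabilisation
    pairings integrable. *)
Lemma Lfun2_enorm v : mu setT \is a fin_num -> L3field v ->
  (fun x => enorm (v x)) \in Lfun mu 2%:E.
Proof.
move=> mufin /Lfun3_enorm; apply: Lfun_subset => //; rewrite lee_fin ?ler1n//.
by rewrite ler_nat.
Qed.

Lemma Lfun1_dotv v w : mu setT \is a fin_num -> L3field v -> L3field w ->
  (fun x => dotv (v x) (w x)) \in Lfun mu 1.
Proof.
move=> mufin v3 w3.
apply: (Lfun_dominated _ _ _
  (Lfun2_mul_Lfun1 (Lfun2_enorm mufin v3) (Lfun2_enorm mufin w3))) => //.
  by apply: measurable_dotv => j; [exact: measurable_Lfun (v3 j)
                                  |exact: measurable_Lfun (w3 j)].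
by move=> x /=; rewrite (le_trans (cauchy_schwarz _ _))// ler_norm.
Qed.

End L3_fields.

(** * The energy inequality for one iteration *)

Section energy.
Context {R : realType} (d : nat) (Omega : set 'rV[R]_d) (oOmega : open Omega).
Local Notation S := (lebesgue_on oOmega).
Hypothesis S_fin : S setT \is a fin_num.
Implicit Types (a u v w : 'rV[R]_d -> 'rV[R]_d) (p q g : 'rV[R]_d -> R).

(** Splitting a real-valued integral into a sum is justified for integrable integrands, so this
    condition accompanies every use of bilinearity of [ipv]. *)
Let pairable a v :=
  (fun x : borelRV R d => dotv (a x) (v x)) \in Lfun S 1.

Lemma L3field_Vspace v : Vspace oOmega v -> L3field (T := borelRV R d) S v.
Proof. by case. Qed.

Lemma Lfun1_mul p q : Wspace oOmega p -> Wspace oOmega q ->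
  (fun x : borelRV R d => p x * q x) \in Lfun S 1.
Proof. exact: Lfun2_mul_Lfun1. Qed.

Lemma Wspace_sub p q : Wspace oOmega p -> Wspace oOmega q ->
  Wspace oOmega (fun x => p x - q x).
Proof.
have le1_2 : (1 <= 2%:E :> \bar R)%E by rewrite lee_fin ler1n.
by move=> p2 q2; apply: (rpredB p2 q2).
Qed.

Lemma ipC p q : ip oOmega p q = ip oOmega q p.
Proof. by apply: eq_Rintegral => x _; rewrite mulrC. Qed.

Lemma ip_subl p q g : Wspace oOmega p -> Wspace oOmega q -> Wspace oOmega g ->
  ip oOmega (fun x => p x - q x) g = ip oOmega p g - ip oOmega q g.
Proof.
move=> p2 q2 g2; rewrite /ip -Rintegral_sub; [|exact: Lfun1_mul..].
by apply: eq_Rintegral => x _; rewrite mulrBl.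
Qed.

Lemma ipv_subr a v w : pairable a v -> pairable a w ->
  ipv oOmega a (fun x => v x - w x) = ipv oOmega a v - ipv oOmega a w.
Proof.
move=> av aw; rewrite /ipv -Rintegral_sub//.
by apply: eq_Rintegral => x _; rewrite dotvDr dotvNr.
Qed.

(** The pointwise bound [forchheimer_coercive] is integrated over the domain. The integral of its
    right side is then evaluated by the equations: the momentum balances turn it into the pairing of
    [s] with the divergence of the velocity error, and the mass balances turn this into
    -|s|^2/tau. *)
Lemma Lscheme_energy (mu k beta gamma L tau M Mrho Lrho : R) (rho : R -> R)
    (f p0 : 'rV[R]_d -> R) u p u' p' U P :
  0 < mu -> 0 < k -> 0 < beta -> 0 <= gamma -> 0 < L -> 0 < tau ->
  2 * k * beta ^+ 2 * Mrho ^+ 2 * M ^+ 2 * (1 + gamma ^+ 2) / mu <= L ->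
  measurable_fun setT rho -> (forall x, 0 <= rho x <= Mrho) ->
  (forall x y, `|rho x - rho y| <= Lrho * `|x - y|) ->
  forchheimer_solution oOmega mu k beta tau rho f p0 u p ->
  Lscheme_step oOmega mu k beta gamma L tau rho f p0 u' p' U P ->
  Vspace oOmega u' -> Wspace oOmega p' ->
  {ae S, forall x, enorm (u' x) <= M} -> {ae S, forall x, enorm (U x) <= M} ->
  (mu / k / 4 + L / 2)
      * ipv oOmega (fun x => U x - u x) (fun x => U x - u x)
    + tau^-1 * ip oOmega (fun x => P x - p x) (fun x => P x - p x)
  <= L / 2 * ipv oOmega (fun x => u' x - u x) (fun x => u' x - u x)
    + k * beta ^+ 2 * Lrho ^+ 2 * M ^+ 4 / mu
      * ip oOmega (fun x => p' x - p x) (fun x => p' x - p x).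
Proof.
move=> mu0 k0 beta0 gamma0 L0 tau0 Llarge mrho rhoM rhoL
  [uV pW equ divu] [UV PW eqU divU] u'V p'W u'M UM.
have [gu gudiv] := uV.2; have [gU gUdiv] := UV.2.
have [guW gUW] : Wspace oOmega gu /\ Wspace oOmega gU.
  by split; [case: gudiv|case: gUdiv].
set e := fun x => U x - u x; set s := fun x => P x - p x.
set e' := fun x => u' x - u x; set s' := fun x => p' x - p x.
have sW : Wspace oOmega s by exact: Wspace_sub.
have s'W : Wspace oOmega s' by exact: Wspace_sub.
have [u3 U3 u'3] := And3 (L3field_Vspace uV) (L3field_Vspace UV)
  (L3field_Vspace u'V).
have e3 : L3field (T := borelRV R d) S e by exact: L3fieldB.
have e'3 : L3field (T := borelRV R d) S e' by exact: L3fieldB.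
set w := fun x => gamma *: u' x + (1 - gamma) *: U x.
have w3 : L3field (T := borelRV R d) S w by apply: L3fieldD; exact: L3fieldZ.
have rho_enorm q v : Wspace oOmega q -> L3field (T := borelRV R d) S v ->
    (fun x : borelRV R d => rho (q x) * enorm (v x)) \in Lfun S 3%:E.
  move=> qW v3; apply: (Lfun_bounded_mul (M := Mrho)).
  - by rewrite ler1n.
  - by apply: (measurableT_comp mrho); exact: measurable_Lfun qW.
  - by move=> x; have /andP[r0 rM] := rhoM (q x); rewrite ger0_norm.
  - exact: Lfun3_enorm.
pose nuU x := (mu / k) *: U x; pose nuu x := (mu / k) *: u x.
pose N' x := (rho (p' x) * enorm (u' x)) *: w x.
pose N x := (rho (p x) * enorm (u x)) *: u x.
pose D x := U x - u' x.
have pN' v : L3field (T := borelRV R d) S v -> pairable N' v.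
  by move=> v3; apply: Lfun1_dotv_scale => //; exact: rho_enorm.
have pN v : L3field (T := borelRV R d) S v -> pairable N v.
  by move=> v3; apply: Lfun1_dotv_scale => //; exact: rho_enorm.
have pU v : L3field (T := borelRV R d) S v -> pairable nuU v.
  by move=> v3; apply: Lfun1_dotv => //; exact: L3fieldZ.
have pu v : L3field (T := borelRV R d) S v -> pairable nuu v.
  by move=> v3; apply: Lfun1_dotv => //; exact: L3fieldZ.
have pD v : L3field (T := borelRV R d) S v -> pairable D v.
  by move=> v3; apply: Lfun1_dotv => //; exact: L3fieldB.
have le1_1 : (1 <= 1 :> \bar R)%E by [].
(* [G] is the integrand of the difference of the two momentum balances tested with [e], pressure
   terms left out. It is nested as a multiple plus a remainder so that [Rintegral_linear] removes
   one term at a time. *)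
pose G x := L * dotv (D x) (e x)
  + (beta * (dotv (N' x) (e x) - dotv (N x) (e x))
     + (dotv (nuU x) (e x) - dotv (nuu x) (e x))).
have G2 : (fun x : borelRV R d => dotv (nuU x) (e x) - dotv (nuu x) (e x))
    \in Lfun S 1 by exact: (rpredB (pU _ e3) (pu _ e3)).
have G1 : (fun x : borelRV R d => dotv (N' x) (e x) - dotv (N x) (e x))
    \in Lfun S 1 by exact: (rpredB (pN' _ e3) (pN _ e3)).
have G12 : (fun x : borelRV R d =>
    beta * (dotv (N' x) (e x) - dotv (N x) (e x))
     + (dotv (nuU x) (e x) - dotv (nuu x) (e x))) \in Lfun S 1.
  exact: (rpredD (rpredZ beta G1) G2).
have G_Lfun : (G : borelRV R d -> R) \in Lfun S 1.
  exact: (rpredD (rpredZ L (pD _ e3)) G12).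
have intG : \int[S]_x G x = L * (ipv oOmega D U - ipv oOmega D u)
   + (beta * (ipv oOmega N' U - ipv oOmega N' u
              - (ipv oOmega N U - ipv oOmega N u))
     + (ipv oOmega nuU U - ipv oOmega nuU u
        - (ipv oOmega nuu U - ipv oOmega nuu u))).
  rewrite /G Rintegral_linear//; last exact: pD.
  rewrite Rintegral_linear// !Rintegral_sub//;
    [|exact: pU|exact: pu|exact: pN'|exact: pN].
  rewrite -!ipv_subr//;
    by [exact: pU|exact: pu|exact: pN'|exact: pN|exact: pD|].
have iss : ip oOmega s s = ip oOmega P s - ip oOmega p s by exact: ip_subl.
have ips q : Wspace oOmega q ->
    ip oOmega q s = ip oOmega P q - ip oOmega p q.
  by move=> qW; rewrite ipC; exact: ip_subl.
pose C := k * beta ^+ 2 * Lrho ^+ 2 * M ^+ 4 / mu.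
rewrite -/C.
(* [H] is the lower bound supplied by [forchheimer_coercive], with the signs moved into the
   coefficients to fit [Rintegral_linear]. *)
pose H x := (mu / k / 4 + L / 2) * dotv (e x) (e x)
  + (- (L / 2) * dotv (e' x) (e' x) + - C * (s' x * s' x)).
have ee : pairable e e by exact: Lfun1_dotv.
have ee' : pairable e' e' by exact: Lfun1_dotv.
have ss' : (fun x : borelRV R d => s' x * s' x) \in Lfun S 1.
  exact: Lfun1_mul.
have Css' : (fun x : borelRV R d => - C * (s' x * s' x)) \in Lfun S 1.
  exact: (rpredZ (- C) ss').
have H2 : (fun x : borelRV R d =>
    - (L / 2) * dotv (e' x) (e' x) + - C * (s' x * s' x)) \in Lfun S 1.
  exact: (rpredD (rpredZ (- (L / 2)) ee') Css').
have H_Lfun : (H : borelRV R d -> R) \in Lfun S 1.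
  exact: (rpredD (rpredZ (mu / k / 4 + L / 2) ee) H2).
have intH : \int[S]_x H x = (mu / k / 4 + L / 2) * ipv oOmega e e
    + (- (L / 2) * ipv oOmega e' e' + - C * ip oOmega s' s').
  rewrite /H Rintegral_linear// Rintegral_linear// RintegralZl//.
  exact/Lfun1_integrable.
have HG : \int[S]_x H x <= \int[S]_x G x.
  apply: ae_le_Rintegral => //; have FS : Filter (nbhs (almost_everywhere S)).
    exact: ae_filter_ringOfSetsType.
  apply: (filterS2 FS _ u'M UM) => x u'xM UxM.
  have := forchheimer_coercive (u x) mu0 k0 beta0 gamma0 L0 Llarge u'xM UxM
    (rhoM (p x)) (rhoM (p' x)) (rhoL (p' x) (p x)).
  rewrite -/(e x) -/(e' x) -/(s' x) -/C => key.
  have -> : H x = (mu / k / 4 + L / 2) * dotv (e x) (e x)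
      - (L / 2 * dotv (e' x) (e' x) + C * s' x ^+ 2) by rewrite /H; ring.
  rewrite (le_trans key)//.
  have expand (a1 a2 b1 b2 c z : 'rV[R]_d) :
      dotv ((a1 - a2) + beta *: (b1 - b2) + L *: c) z = L * dotv c z
        + (beta * (dotv b1 z - dotv b2 z) + (dotv a1 z - dotv a2 z)).
    by rewrite !(dotvDl, dotvNl, dotvZl); ring.
  by rewrite [_ *: e x]scalerBr expand.
(* Testing with both velocities separately, rather than with e, avoids the weak
   divergence of e. *)
have u_u : ipv oOmega nuu u + beta * ipv oOmega N u - ip oOmega p gu = 0.
  exact: equ.
have u_U : ipv oOmega nuu U + beta * ipv oOmega N U - ip oOmega p gU = 0.
  exact: equ.
have U_u : ipv oOmega nuU u + beta * ipv oOmega N' u + L * ipv oOmega D u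
    - ip oOmega P gu = 0 by exact: eqU.
have U_U : ipv oOmega nuU U + beta * ipv oOmega N' U + L * ipv oOmega D U
    - ip oOmega P gU = 0 by exact: eqU.
(* Both mass balances carry the same data on the right, so equating them for the test function [s]
   eliminates [p0] and [f]. *)
have := divU _ s gUdiv sW; rewrite -(divu _ s gudiv sW) (ips gu)// (ips gU)//.
move=> div_s.
(* The combination [U_U] - [U_u] - [u_U] + [u_u] expresses the integral of [G] by pressure pairings
   only, and [div_s] identifies their sum. *)
have Gss : \int[S]_x G x = - (tau^-1 * ip oOmega s s).
  apply: (mulfI (lt0r_neq0 tau0)); rewrite mulrN mulVKf ?lt0r_neq0// iss intG.
  have -> : L * (ipv oOmega D U - ipv oOmega D u)
      + (beta * (ipv oOmega N' U - ipv oOmega N' u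
                 - (ipv oOmega N U - ipv oOmega N u))
        + (ipv oOmega nuU U - ipv oOmega nuU u
           - (ipv oOmega nuu U - ipv oOmega nuu u)))
      = ip oOmega P gU - ip oOmega p gU - (ip oOmega P gu - ip oOmega p gu).
    by lra.
  by lra.
by move: HG; rewrite Gss intH; lra.
Qed.

End energy.

(** * Essential bounds, finite measure of the domain, and the L^2 norms *)

Lemma Lnorm_pinfty_ae disp (T : measurableType disp) (R : realType)
    (mu : {measure set T -> \bar R}) (f : T -> R) (M : R) :
  ('N[mu]_+oo[(fun x => (f x)%:E)] <= M%:E)%E -> {ae mu, forall x, f x <= M}.
Proof.
rewrite unlock /=; case: ifPn => [_ /ess_supP|].
  by apply: filterS => x /=; rewrite lee_fin; apply: le_trans; exact: ler_norm.
(* If the whole space is null, the norm carries no information, but the whole space may serve as the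
   exceptional set. *)
rewrite -leNgt => mu0 _; exists setT; split => //.
by apply/eqP; rewrite eq_le mu0 measure_ge0.
Qed.

Section domain.
Context {R : realType} (d : nat) (Omega : set 'rV[R]_d) (oOmega : open Omega).
Local Notation S := (lebesgue_on oOmega).

Lemma lebesgue_on_fin_num : bounded_set Omega -> S setT \is a fin_num.
Proof.
(* [bounded_set] bounds the norm by every real strictly above [M]; |M| + 1 is such a real and is
   positive. The norm on row vectors is the maximum norm, so the domain lies in the box from -b to
   b. *)
move=> [M [_ OmegaM]]; pose b : 'rV[R]_d := const_mx (`|M| + 1).
have b0 j : (- b) 0 j <= b 0 j.
  by rewrite !mxE; have := normr_ge0 M; lra.
rewrite ge0_fin_numE ?measure_ge0//= /mrestr setTI.
apply: (@le_lt_trans _ _ (\prod_j (b 0 j - (- b) 0 j))%:E); last exact: ltry.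
rewrite -lebesgue_rV_box//; apply: le_measure; rewrite ?inE.
- exact: open_borel.
- exact: measurable_box.
move=> x Omegax j; have xM : `|x| <= `|M| + 1.
  by apply: OmegaM => //; rewrite (le_lt_trans (ler_norm M))// ltrDl.
rewrite !mxE -ler_norml; apply: le_trans xM.
rewrite [leRHS]/Num.norm/= mx_normrE.
by apply/bigmax_geP; right => /=; exists (0, j).
Qed.

Lemma Linfty_norm_ae (u : 'rV[R]_d -> 'rV[R]_d) (M : R) :
  (Linfty_norm oOmega u <= M%:E)%E -> {ae S, forall x, enorm (u x) <= M}.
Proof. exact: Lnorm_pinfty_ae. Qed.

Lemma cvg_L2_norm (p : nat -> 'rV[R]_d -> R) :
  (forall i, Wspace oOmega (p i)) ->
  ip oOmega (p i) (p i) @[i --> \oo] --> (0 : R) ->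
  L2_norm oOmega (p i) @[i --> \oo] --> (0 : \bar R).
Proof.
move=> pW p0.
rewrite (_ : (fun i => _) =
    EFin \o (fun i => Num.sqrt (ip oOmega (p i) (p i)))).
  apply: cvg_EFin; first exact: nearW.
  by rewrite -sqrtr0; apply: continuous_cvg p0; exact: sqrt_continuous.
apply/funext => i /=; rewrite /L2_norm Lfun2_Lnorm//; exact: pW.
Qed.

Lemma L2_normvE (u : 'rV[R]_d -> 'rV[R]_d) :
  L2_normv oOmega u = L2_norm oOmega (fun x => enorm (u x)).
Proof. by []. Qed.

Lemma ip_enorm (u : 'rV[R]_d -> 'rV[R]_d) :
  ip oOmega (fun x => enorm (u x)) (fun x => enorm (u x)) = ipv oOmega u u.
Proof. by apply: eq_Rintegral => x _; rewrite -expr2 sqr_enorm. Qed.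

End domain.

(** * Choice of the time step and convergence of the scheme *)

Theorem theorem1 (R : realType)
    (mu k beta gamma L M_u m_rho M_rho L_rho : R)
    (mu_gt0 : 0 < mu) (k_gt0 : 0 < k) (beta_gt0 : 0 < beta)
    (gamma_ge0 : 0 <= gamma) (gamma_le1 : gamma <= 1)
    (L_ge0 : 0 <= L) (M_u_gt0 : 0 < M_u) (m_rho_gt0 : 0 < m_rho)
    (L_large : 2 * k * beta ^+ 2 * M_rho ^+ 2 * M_u ^+ 2 * (1 + gamma ^+ 2) / mu
                 < L) :
  exists2 tau0 : R, 0 < tau0 &
  forall (d : nat) (Omega : set 'rV[R]_d.+1) (oOmega : open Omega)
    (rho : R -> R) (T : R) (N n : nat)
    (u : nat -> 'rV[R]_d.+1 -> 'rV[R]_d.+1) (p f : nat -> 'rV[R]_d.+1 -> R)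
    (us : nat -> 'rV[R]_d.+1 -> 'rV[R]_d.+1) (ps : nat -> 'rV[R]_d.+1 -> R),
  let tau := T / N%:R in
  lipschitz_domain Omega ->
  0 < T -> (1 <= N)%N -> (1 <= n <= N)%N ->
  L_rho.-lipschitz rho -> {homo rho : x y / x <= y} ->
  (forall x, m_rho <= rho x <= M_rho) ->
  Wspace oOmega (f n) -> Vspace oOmega (u n.-1) -> Wspace oOmega (p n.-1) ->
  forchheimer_solution oOmega mu k beta tau rho (f n) (p n.-1) (u n) (p n) ->
  Lscheme oOmega mu k beta gamma L tau rho (f n) (p n.-1) (u n.-1) us ps ->
  (forall i, Linfty_norm oOmega (us i) <= M_u%:E)%E ->
  tau < tau0 ->
  L2_normv oOmega (fun x => us i x - u n x) @[i --> \oo] --> (0 : \bar R) /\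
  L2_norm oOmega (fun x => ps i x - p n x) @[i --> \oo] --> (0 : \bar R).
Proof.
pose C := k * beta ^+ 2 * L_rho ^+ 2 * M_u ^+ 4 / mu.
have C_ge0 : 0 <= C.
  rewrite [C](_ : _ = k / mu * (beta * L_rho * M_u ^+ 2) ^+ 2).
    exact: mulr_ge0 (divr_ge0 (ltW k_gt0) (ltW mu_gt0)) (sqr_ge0 _).
  by rewrite /C; ring.
have L_gt0 : 0 < L.
  apply: le_lt_trans L_large.
  rewrite [leRHS](_ : _ =
    2 * (k / mu) * (beta * M_rho * M_u) ^+ 2 * (1 + gamma ^+ 2)); last by ring.
  apply: mulr_ge0; last by rewrite addr_ge0 ?sqr_ge0.
  apply: mulr_ge0 (sqr_ge0 _).
  by rewrite mulr_ge0 ?divr_ge0 ?ltW.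
have C1_gt0 : 0 < C + 1 by rewrite ltr_wpDl.
(* The summand 1 keeps the inverse positive when [C] = 0, and tau < 1/(C + 1) gives C < 1/tau. The
   choice precedes the domain, the data and the iterates, so it is uniform in them. *)
exists (C + 1)^-1; first by rewrite invr_gt0.
move=> d Omega oOmega rho T N n u p f us ps tau [_ _ Omega_bnd _] T_gt0 N_gt0 _.
move=> rho_lip rho_incr rho_bnd fW uV pW sol [us0 ps0 step] us_bnd tau_lt.
have tau_gt0 : 0 < tau by rewrite divr_gt0// ltr0n.
have C_lt : C < tau^-1.
  apply: (@lt_trans _ _ (C + 1)); first by rewrite ltrDl.
  by rewrite -[C + 1]invrK ltf_pV2// posrE invr_gt0.
have S_fin := lebesgue_on_fin_num oOmega Omega_bnd.
(* Measurability of the density comes from its monotonicity. *)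
have mrho : measurable_fun setT rho.
  apply: nondecreasing_measurable => // x y _ _; exact: rho_incr.
have rhoM x : 0 <= rho x <= M_rho.
  by have /andP[r0 ->] := rho_bnd x; rewrite (le_trans (ltW m_rho_gt0)).
have rhoL x y : `|rho x - rho y| <= L_rho * `|x - y| by exact: (rho_lip (x, y)).
have usV i : Vspace oOmega (us i).
  by case: i => [|i]; [rewrite us0|case: (step i)].
have psW i : Wspace oOmega (ps i).
  by case: i => [|i]; [rewrite ps0|case: (step i)].
have [unV pnW _ _] := sol.
(* The mass balance of the scheme is stated with the initial iterate; replacing it by the previous
   time level gives it the same data as problem (P). *)
rewrite ps0 in step.
have energy i := Lscheme_energy S_fin mu_gt0 k_gt0 beta_gt0 gamma_ge0 L_gt0
  tau_gt0 (ltW L_large) mrho rhoM rhoL sol (step i) (usV i) (psW i)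
  (Linfty_norm_ae (us_bnd i)) (Linfty_norm_ae (us_bnd i.+1)).
(* The velocity weight decreases strictly thanks to the margin mu/(4k) left from the Darcy term, the
   pressure weight thanks to the small time step. *)
have coefL : 0 <= L / 2 < mu / k / 4 + L / 2.
  by rewrite divr_ge0//= ltrDr !divr_gt0.
have coefC : 0 <= C < tau^-1 by rewrite C_ge0.
have e_ge0 i : 0 <= ipv oOmega (fun x => us i x - u n x)
    (fun x => us i x - u n x).
  by apply: Rintegral_ge0 => x _; exact: dotvv_ge0.
have s_ge0 i : 0 <= ip oOmega (fun x => ps i x - p n x)
    (fun x => ps i x - p n x).
  by apply: Rintegral_ge0 => x _; rewrite -expr2 sqr_ge0.
have [e_cvg0 s_cvg0] :=
  cvg0_of_weighted_contraction coefL coefC e_ge0 s_ge0 energy.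
split.
  under eq_fun do rewrite L2_normvE.
  apply: cvg_L2_norm; last by under eq_fun do rewrite ip_enorm.
  by move=> i; apply: Lfun2_enorm => //; apply: L3fieldB; exact: L3field_Vspace.
by apply: cvg_L2_norm => // i; exact: Wspace_sub.
Qed.
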